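(* Let $d,k\ge 1$ be integers, $n=dk$, and let $N_1,\dots,N_d\in\mathbb{C}^{k\times k}$ with $N_d$ upper triangular. Let $T\in\mathbb{C}^{n\times n}$ be the matrix $$T=\begin{bmatrix} I_k & & & & N_1\\ & I_k & & & \\ & & \ddots & & \vdots\\ & & & I_k & N_{d-1}\\ & & & & N_d\end{bmatrix}.$$ Then $T$ can be factored as $T=T_1T_2\cdots T_k$, where each $T_i\in\mathbb{C}^{n\times n}$ is upper triangular and of identity-plus-spike form.
   Context: $I_k$ is the $k\times k$ identity matrix; blank entries are zero. The matrix $T$ has $k\times k$ blocks: its first $d-1$ block columns agree with those of the identity, and its last block column consists of $N_1,\dots,N_d$ from top to bottom. An $n\times n$ matrix is of identity-plus-spike form if it is the sum of the identity $I_n$ and a rank-one matrix having a single nonzero column, i.e. it equals $I_n+ve_\ell^T$ for some $v\in\mathbb{C}^n$ and some standard basis vector $e_\ell$ (the degenerate case $v=0$ is allowed). *)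

(* Defs.v *)
From mathcomp Require Import all_boot all_order all_algebra.
From mathcomp Require Import reals complex.

Set Implicit Arguments.
Unset Strict Implicit.
Unset Printing Implicit Defensive.

Import GRing.Theory.
Local Open Scope ring_scope.

(* [is_trig_mx] is lower triangularity, hence the transpose. *)
Definition upper_triangular (R : nzRingType) (n : nat) (A : 'M[R]_n) : Prop :=
  is_trig_mx A^T.

(* [v = 0] is allowed; [delta_mx 0 l : 'rV_n] is the transpose of the basis
   vector of index [l]. *)
Definition identity_plus_spike (R : nzRingType) (n : nat) (A : 'M[R]_n) : Prop :=
  exists (v : 'cV[R]_n) (l : 'I_n), A = 1%:M + v *m delta_mx 0 l.

Lemma sum_const_ord (d k : nat) : (\sum_(i < d) k = d * k)%N.
Proof. by rewrite sum_nat_const card_ord. Qed.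

Definition block_spike_entry (R : nzRingType) (d k : nat)
    (N : 'I_d -> 'M[R]_k) (i j : 'I_d) : 'M[R]_k :=
  if j == d.-1 :> nat then N i else if i == j then 1%:M else 0.

(* [\mxblock] has size [\sum_(i < d) k], which is only propositionally equal
   to [d * k]. *)
Definition block_spike (R : nzRingType) (d k : nat)
    (N : 'I_d -> 'M[R]_k) : 'M[R]_(d * k) :=
  castmx (sum_const_ord d k, sum_const_ord d k)
    (\mxblock_(i < d, j < d) block_spike_entry N i j).

(* Main.v *)
(** An upper triangular matrix can be peeled one column at a time: if [A] agrees
with the identity in its first [l] columns and [u] is supported on the first
[l] coordinates, then [A u = u].  Hence multiplying, from the last column to the
first, the matrices obtained from the identity by installing a single column of
[T] rebuilds [T].  Only the last [k] columns of the block matrix differ from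
those of the identity, so [k] factors suffice. *)
Require Import Defs.
From mathcomp Require Import all_boot all_order all_algebra.
From mathcomp Require Import reals complex.

Set Implicit Arguments.
Unset Strict Implicit.
Unset Printing Implicit Defensive.

Import GRing.Theory.
Local Open Scope ring_scope.

(** A predicate, rather than a single index, lets one notion cover both the individual factors
    ([pred1 l]) and their partial products (a final segment of columns). *)
Definition identity_with_columns (R : nzRingType) (n : nat) (P : pred 'I_n)
    (M : 'M[R]_n) : 'M[R]_n :=
  \matrix_(i, j) if P j then M i j else (i == j)%:R.

Lemma upper_triangularP (R : nzRingType) (n : nat) (M : 'M[R]_n) :
  upper_triangular M <-> forall i j : 'I_n, (j < i)%N -> M i j = 0.
Proof.
split=> [/is_trig_mxP tM i j ji|tM]; first by have := tM _ _ ji; rewrite mxE.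
by apply/is_trig_mxP => i j ij; rewrite mxE tM.
Qed.

Lemma upper_identity_with_columns (R : nzRingType) (n : nat) (P : pred 'I_n)
    (M : 'M[R]_n) :
  upper_triangular M -> upper_triangular (identity_with_columns P M).
Proof.
move=> /upper_triangularP tM; apply/upper_triangularP => i j ji.
by rewrite mxE tM // -val_eqE gtn_eqF // if_same.
Qed.

Lemma spike_identity_with_column (R : nzRingType) (n : nat) (l : 'I_n)
    (M : 'M[R]_n) :
  identity_plus_spike (identity_with_columns (pred1 l) M).
Proof.
exists (col l M - delta_mx l 0), l; apply/matrixP => i j.
rewrite !mxE big_ord1 !mxE /= eqxx andbT.
by case: eqVneq => [->|_]; rewrite ?mulr1 ?subrKC ?mulr0 ?addr0.
Qed.

Lemma identity_with_columnsM (R : nzRingType) (n : nat) (P Q : pred 'I_n)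
    (M : 'M[R]_n) :
  upper_triangular M -> (forall j l, Q j -> P l -> (j < l)%N) ->
  identity_with_columns P M * identity_with_columns Q M =
  identity_with_columns (predU P Q) M.
Proof.
move=> /upper_triangularP tM QP; apply/matrixP => i j; rewrite !mxE /=.
case: (boolP (Q j)) => Qj; last first.
  (* Column [j] of the right factor is a basis vector, which selects column [j] of the left
     factor. *)
  rewrite orbF (bigD1 j) //= big1 => [|l lj]; last first.
    by rewrite !mxE (negbTE Qj) (negbTE lj) mulr0.
  by rewrite addr0 !mxE (negbTE Qj) eqxx mulr1.
(* The left factor may be replaced by the identity: its altered columns [l] lie beyond [j], where
   [M l j] vanishes. *)
rewrite orbT; transitivity (\sum_l (i == l)%:R * M l j).
  apply: eq_bigr => l _; rewrite !mxE Qj.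
  by case: ifP => // Pl; rewrite (tM _ _ (QP _ _ Qj Pl)) !mulr0.
rewrite (bigD1 i) //= eqxx mul1r big1 ?addr0 // => l.
by rewrite eq_sym => /negbTE ->; rewrite mul0r.
Qed.

Lemma prod_identity_with_column (R : nzRingType) (n m : nat) (M : 'M[R]_n) :
  upper_triangular M -> (m <= n)%N ->
  \prod_(i < m) identity_with_columns [pred j : 'I_n | j == n - i.+1 :> nat]%N M
  = identity_with_columns [pred j : 'I_n | n - m <= j]%N M.
Proof.
move=> tM; elim: m => [_|m IHm mn].
  rewrite big_ord0; apply/matrixP => i j.
  by rewrite !mxE /= subn0 leqNgt ltn_ord.
rewrite big_ord_recr /= IHm 1?ltnW // identity_with_columnsM //=; last first.
  by move=> j l /= /eqP ->; apply: leq_trans; rewrite ltn_sub2l.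
apply/matrixP => i j; rewrite !mxE /=.
by rewrite (leq_eqVlt (n - m.+1)) subnSK // orbC [in RHS]eq_sym.
Qed.

Lemma upper_triangular_factorization (R : nzRingType) (n k : nat)
    (M : 'M[R]_n) :
  (k <= n)%N -> upper_triangular M ->
  (forall i j : 'I_n, (j < n - k)%N -> M i j = (i == j)%:R) ->
  exists T_ : 'I_k -> 'M[R]_n,
    M = \prod_(i < k) T_ i /\
    forall i, upper_triangular (T_ i) /\ identity_plus_spike (T_ i).
Proof.
move=> kn tM idM.
exists (fun i => identity_with_columns (pred1 (rev_ord (widen_ord kn i))) M).
split=> [|i]; last first.
  split; first exact: upper_identity_with_columns.
  exact: spike_identity_with_column.
transitivity (identity_with_columns [pred j : 'I_n | n - k <= j]%N M).
  by apply/matrixP => i j; rewrite !mxE /=; case: leqP => // /idM.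
rewrite -prod_identity_with_column //; exact: eq_bigr.
Qed.

Lemma upper_triangular_castmx (R : nzRingType) (m n : nat) (e : m = n)
    (M : 'M[R]_m) :
  upper_triangular M -> upper_triangular (castmx (e, e) M).
Proof. by case: n / e. Qed.

Lemma upper_triangular_block_spike (R : nzRingType) (d k : nat)
    (N : 'I_d -> 'M[R]_k) :
  (forall l : 'I_d, l = d.-1 :> nat -> upper_triangular (N l)) ->
  upper_triangular (block_spike N).
Proof.
move=> hN; apply: upper_triangular_castmx.
rewrite /upper_triangular tr_mxblock; apply/is_trig_mxblockP.
split=> [i j ij|i]; rewrite /block_spike_entry.
  (* Because of the transposition, [i] is the block column in [block_spike_entry]; [i < j] keeps it
     off the last one. *)
  have ilast : (i < d.-1)%N.
    by apply: leq_trans ij _; rewrite -ltnS (ltn_predK (ltn_ord j)).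
  by rewrite (ltn_eqF ilast) -val_eqE (gtn_eqF ij) trmx0.
case: eqP => [/hN //|_].
by rewrite eqxx trmx1 scalar_mx_is_trig.
Qed.

Lemma block_spike_identity_column (R : nzRingType) (d k : nat)
    (N : 'I_d -> 'M[R]_k) (i j : 'I_(d * k)) :
  (j < d * k - k)%N -> block_spike N i j = (i == j)%:R.
Proof.
rewrite /block_spike castmxE /=.
have e : (i == j) = (cast_ord (esym (sum_const_ord d k)) i ==
                     cast_ord (esym (sum_const_ord d k)) j).
  by rewrite (inj_eq (@cast_ord_inj _ _ _)).
(* The cast preserves values, so the bound on [j] survives generalizing the cast indices. *)
rewrite {}e -[X in (X < _)%N]/
  (nat_of_ord (cast_ord (esym (sum_const_ord d k)) j)).
move: (cast_ord _ i) (cast_ord _ j) => {}i {}j jlt.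
(* Offsets are compared in [nat] since their type depends on the block. *)
have ij : (i == j) = (tagnat.sig1 i == tagnat.sig1 j) &&
                      (tagnat.sig2 i == tagnat.sig2 j :> nat).
  by rewrite -tagnat.eq_Rank !tagnat.sig2K.
rewrite {}ij mxE /block_spike_entry ifN.
  case: eqVneq => [sij|_]; last by rewrite mxE.
  by rewrite mxE -val_eqE.
(* An index in the last block is preceded by [d.-1] full blocks, hence is at least [d * k - k]. *)
apply: contraTneq jlt => jlast; rewrite -leqNgt (tagnat.rect j).
rewrite (big_ord_narrow (ltnW (ltn_ord _))) sum_const_ord jlast -subn1.
by rewrite mulnBl mul1n leq_addr.
Qed.

Theorem theorem4 (R : realType) (d k : nat) (hd : (0 < d)%N) (hk : (0 < k)%N)
    (N : 'I_d -> 'M[R[i]]_k)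
    (hN : forall l : 'I_d, l = d.-1 :> nat -> upper_triangular (N l)) :
  exists T_ : 'I_k -> 'M[R[i]]_(d * k),
    block_spike N = \prod_(i < k) T_ i /\
    forall i : 'I_k, upper_triangular (T_ i) /\ identity_plus_spike (T_ i).
Proof.
apply: upper_triangular_factorization; first by rewrite leq_pmull.
  exact: upper_triangular_block_spike.
exact: block_spike_identity_column.
Qed.
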